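(* Let $A\in SL(\mathbb{Z},2)$ and suppose that all eigenvalues of $A$ have modulus $1$. Let $\mathbf{c}=(c_n)_{n\ge1}$ be an oscillating sequence of complex numbers satisfying the growth condition $\sum_{n=1}^N|c_n|^\lambda=O(N)$ for some $\lambda>1$. Then $\mathbf{c}$ is linearly disjoint from the flow $\mathcal{X}=(\mathbb{T}^2,\ T\mathbf{x}=A\mathbf{x})$.
   Context: $\mathbb{T}^2=\mathbb{R}^2/\mathbb{Z}^2$ with its standard metric. $SL(\mathbb{Z},2)$ denotes the set of $2\times2$ integer matrices $A$ with $\det A=\pm1$. A sequence $(c_n)_{n\ge1}$ of complex numbers is oscillating if $\lim_{N\to\infty}\frac1N\sum_{n=1}^N c_n e^{-2\pi i n t}=0$ for every $t\in[0,1)$. For a compact metric space $X$ and a continuous map $T:X\to X$, $(c_n)$ is linearly disjoint from the flow $(X,T)$ if $\lim_{N\to\infty}\frac1N\sum_{n=1}^N c_n f(T^n x)=0$ for every continuous $f:X\to\mathbb{C}$ and every $x\in X$. *)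

(* Defs.v *)
From HB Require Import structures.
From mathcomp Require Import all_boot all_order all_algebra.
From mathcomp Require Import all_classical all_reals all_analysis.
From mathcomp Require Import complex.
From mathcomp Require Import ring lra.

Set Implicit Arguments.
Unset Strict Implicit.
Unset Printing Implicit Defensive.

Import Order.TTheory GRing.Theory Num.Theory.
Import numFieldNormedType.Exports.
Import Normc.

Local Open Scope classical_set_scope.
Local Open Scope ring_scope.
Local Open Scope quotient_scope.
Local Open Scope complex_scope.

(* The usual topology on the complex numbers R[i] is reached through the alias
   R[i]^o, which is convertible to R[i].  In a sequence c : nat -> R[i], the
   entry c 0 is never used: all sums below start at n = 1. *)

Section Sequences.
Variable R : realType.

Definition expi (t : R) : R[i] := cos t +i* sin t.

(* (1/N) (u_1 + ... + u_N) *)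
Definition cesaro_mean (u : nat -> R[i]) (N : nat) : R[i]^o :=
  (N%:R)^-1 * \sum_(1 <= n < N.+1) u n.

Definition oscillating (c : nat -> R[i]) : Prop :=
  forall t : R, 0 <= t < 1 ->
    cesaro_mean (fun n => c n * expi (- (2 * pi * n%:R * t))) @ \oo
      --> (0 : R[i]^o).

(* normc is the R-valued modulus (`|z| lives in R[i]). *)
Definition growth_condition (lambda : R) (c : nat -> R[i]) : Prop :=
  (fun N : nat => \sum_(1 <= n < N.+1) normc (c n) `^ lambda : R^o)
    =O_\oo (fun N : nat => N%:R : R^o).

Record flow := Flow {
  flow_space :> metricType R;
  flow_map : flow_space -> flow_space;
  flow_compact : compact [set: flow_space];
  flow_continuous : continuous flow_map }.

Definition linearly_disjoint (c : nat -> R[i]) (X : flow) : Prop :=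
  forall f : X -> R[i]^o, continuous f -> forall x : X,
    cesaro_mean (fun n => c n * f (iter n (@flow_map X) x)) @ \oo
      --> (0 : R[i]^o).

End Sequences.

(* SL(Z,2) is understood here to include the matrices of determinant -1. *)
Definition SL_Z2 : set 'M[int]_2 := [set A | \det A = 1 \/ \det A = -1].

(* eigenvalue refers to row eigenvectors; a square matrix and its transpose
   have the same eigenvalues. *)
Definition eigenvalues_on_unit_circle (R : realType) (A : 'M[int]_2) : Prop :=
  forall z : R[i], eigenvalue (map_mx intr A : 'M[R[i]]_2) z -> `|z| = 1.

Section Torus.
Variable R : realType.
Implicit Types u v w : 'cV[R]_2.

Definition torus_equiv u v : bool :=
  [forall i, u i 0 - v i 0 \is a Num.int].

Lemma torus_equivP u v :
  reflect (forall i, u i 0 - v i 0 \is a Num.int) (torus_equiv u v).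
Proof. exact: forallP. Qed.

Lemma torus_equiv_is_equiv : equiv_class_of torus_equiv.
Proof.
split=> [u|u v|v u w].
- by apply/torus_equivP => i; rewrite subrr rpred0.
- apply/torus_equivP/torus_equivP => uv i; by rewrite -opprB rpredN.
- move=> /torus_equivP uv /torus_equivP vw; apply/torus_equivP => i.
  by rewrite -(subrK (v i 0) (u i 0)) -addrA rpredD.
Qed.

Canonical torus_equiv_rel := EquivRelPack torus_equiv_is_equiv.

Definition torus : Type := {eq_quot torus_equiv}.
HB.instance Definition _ := Choice.on torus.
HB.instance Definition _ := EqQuotient.on torus.

Definition to_torus u : torus := \pi_torus u.

Lemma to_torusP u v : to_torus u = to_torus v <-> torus_equiv u v.
Proof. by split=> [/eqmodP|?]//; apply/eqmodP. Qed.

Lemma to_torus_repr (p : torus) : to_torus (repr p) = p.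
Proof. exact: reprK. Qed.

Definition enorm u : R := Num.sqrt (\sum_(i < 2) u i 0 ^+ 2).

(* The quotient metric on R^2/Z^2: the distance between two classes is the
   infimum of the Euclidean distances between their representatives, i.e.
   min_(k in Z^2) |u - v + k| for any representatives u and v.  The topology
   on torus is the one induced by this metric. *)
Definition lift_dists (p q : torus) : set R :=
  [set r | exists u v, [/\ to_torus u = p, to_torus v = q & r = enorm (u - v)]].

Definition torus_dist (p q : torus) : R := inf (lift_dists p q).

Lemma enormE u : enorm u = normc (u 0 0 +i* u 1 0).
Proof.
rewrite /enorm /= !big_ord_recl big_ord0 addr0.
by congr (Num.sqrt (_ ^+ 2 + u _ _ ^+ 2)); apply/val_inj.
Qed.

Lemma enorm_ge0 u : 0 <= enorm u.
Proof. exact: sqrtr_ge0. Qed.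

Lemma enorm0 : enorm 0 = 0.
Proof. by rewrite enormE !mxE normc0. Qed.

Lemma enormN u : enorm (- u) = enorm u.
Proof. by rewrite !enormE !mxE /= !sqrrN. Qed.

Lemma enorm_triangle u v : enorm (u + v) <= enorm u + enorm v.
Proof. by rewrite !enormE !mxE; apply: le_trans (le_normcD _ _). Qed.

Lemma enorm_entry u i : `|u i 0| <= enorm u.
Proof.
rewrite -sqrtr_sqr ler_wsqrtr// (bigD1 i)//= lerDl.
by apply: sumr_ge0 => j _; exact: sqr_ge0.
Qed.

Lemma enorm_le_sum u : enorm u <= \sum_(i < 2) `|u i 0|.
Proof.
have s0 : 0 <= \sum_(i < 2) `|u i 0| by apply: sumr_ge0.
rewrite -(ger0_norm s0) -sqrtr_sqr ler_wsqrtr// !big_ord_recl !big_ord0 !addr0.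
rewrite -(real_normK (num_real (u ord0 0))).
rewrite -(real_normK (num_real (u (lift ord0 ord0) 0))).
by rewrite sqrrD -addrA lerD2l [leRHS]addrC lerDl mulrn_wge0.
Qed.

Lemma lift_dists_lb p q : has_lbound (lift_dists p q).
Proof. by exists 0 => _ [u [v [_ _ ->]]]; exact: enorm_ge0. Qed.

Lemma lift_dists_neq0 p q : lift_dists p q !=set0.
Proof.
by exists (enorm (repr p - repr q)), (repr p), (repr q); rewrite !to_torus_repr.
Qed.

Lemma torus_dist_le u v : torus_dist (to_torus u) (to_torus v) <= enorm (u - v).
Proof. by apply: ge_inf; [exact: lift_dists_lb|exists u, v]. Qed.

Lemma torus_dist_ge0 p q : 0 <= torus_dist p q.
Proof.
apply: lb_le_inf; first exact: lift_dists_neq0.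
by move=> _ [u [v [_ _ ->]]]; exact: enorm_ge0.
Qed.

Lemma torus_dist_lift u q (e : R) : torus_dist (to_torus u) q < e ->
  exists2 v, to_torus v = q & enorm (u - v) < e.
Proof.
move=> /(inf_lt (lift_dists_neq0 _ _))[_ [u' [v' [u'u v'q ->]]] lte].
exists (u - u' + v'); last by rewrite opprD addrA opprB [u + _]addrC subrK.
rewrite -v'q; apply/to_torusP/torus_equivP => i; rewrite !mxE addrK.
by move/to_torusP/torus_equivP: u'u => /(_ i); rewrite -opprB rpredN.
Qed.

Lemma torus_distxx p : torus_dist p p = 0.
Proof.
apply/eqP; rewrite eq_le torus_dist_ge0 andbT -(to_torus_repr p).
by apply: le_trans (torus_dist_le _ _) _; rewrite subrr enorm0.
Qed.

Lemma torus_dist_sym p q : torus_dist p q = torus_dist q p.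
Proof.
congr inf; apply/seteqP; split=> _ [u [v [up vq ->]]]; exists v, u;
  by rewrite -enormN opprB.
Qed.

Lemma torus_dist_triangle q p r :
  torus_dist p r <= torus_dist p q + torus_dist q r.
Proof.
apply/ler_addgt0Pr => e e0; have e20 : 0 < e / 2 by rewrite divr_gt0.
have [|v vq uv] := @torus_dist_lift (repr p) q (torus_dist p q + e / 2).
  by rewrite to_torus_repr ltrDl.
have [|w wr vw] := @torus_dist_lift v r (torus_dist q r + e / 2).
  by rewrite vq ltrDl.
rewrite -(to_torus_repr p) -wr; apply: le_trans (torus_dist_le _ _) _.
rewrite to_torus_repr wr -(subrK v (repr p)) -addrA.
apply: le_trans (enorm_triangle _ _) _; lra.
Qed.

Lemma torus_dist_positivity p q : torus_dist p q = 0 -> p = q.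
Proof.
move=> pq0; have [|v vq uv] := @torus_dist_lift (repr p) q (2^-1).
  by rewrite to_torus_repr pq0 invr_gt0.
suff -> : p = to_torus v by [].
rewrite -[LHS]to_torus_repr; congr to_torus; apply/matrixP => i j.
rewrite (ord1 j); apply/eqP; rewrite -subr_eq0; apply/negPn/negP.
rewrite -normr_gt0 => d0.
have [|v' v'q uv'] := @torus_dist_lift (repr p) q
    (Num.min (2^-1) `|repr p i 0 - v i 0|).
  by rewrite to_torus_repr pq0 lt_min d0 invr_gt0 ltr0n.
move: uv'; rewrite lt_min => /andP[uv'2 uv'd].
have /torus_equivP/(_ i) vv' : torus_equiv v v'.
  by apply/to_torusP; rewrite vq v'q.
have := enorm_entry (repr p - v) i; rewrite !mxE => h1.
have := enorm_entry (repr p - v') i; rewrite !mxE => h2.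
have [vv'E|vv'N] := eqVneq (v i 0 - v' i 0) 0.
  move: h2; have /eqP -> : v' i 0 == v i 0 by rewrite eq_sym -subr_eq0 vv'E.
  by rewrite leNgt uv'd.
have := norm_intr_ge1 vv' vv'N; apply/negP; rewrite -ltNge.
have -> : v i 0 - v' i 0 = (repr p i 0 - v' i 0) - (repr p i 0 - v i 0) by ring.
apply: le_lt_trans (ler_normB _ _) _; lra.
Qed.

HB.instance Definition _ := @isMetric.Build R torus torus_dist
  torus_distxx torus_dist_positivity torus_dist_sym torus_dist_triangle.

Variable A : 'M[int]_2.

(* Independent of the chosen representative, see torus_mapE. *)
Definition torus_map (p : torus) : torus :=
  to_torus (map_mx intr A *m repr p).

Lemma torus_mapE u : torus_map (to_torus u) = to_torus (map_mx intr A *m u).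
Proof.
apply/to_torusP/torus_equivP => i; rewrite !mxE -sumrB rpred_sum// => j _.
rewrite -mulrBr mxE rpredM ?intr_int//.
by have /to_torusP/torus_equivP := to_torus_repr (to_torus u).
Qed.

Lemma enorm_mulmx (B : 'M[R]_2) u :
  enorm (B *m u) <= (\sum_(i < 2) \sum_(j < 2) `|B i j|) * enorm u.
Proof.
apply: le_trans (enorm_le_sum _) _; rewrite mulr_suml; apply: ler_sum => i _.
rewrite mxE mulr_suml; apply: le_trans (ler_norm_sum _ _ _) _.
by apply: ler_sum => j _; rewrite normrM ler_wpM2l// enorm_entry.
Qed.

Lemma torus_map_continuous : continuous torus_map.
Proof.
move=> p; apply/(metricType_numDomainType.cvgrPdist_lt (FF := nbhs_filter _)) => e e0.
pose K := \sum_(i < 2) \sum_(j < 2) `|(map_mx intr A : 'M[R]_2) i j| + 1.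
have K0 : 0 < K by rewrite ltr_wpDl// !sumr_ge0// => i _; rewrite sumr_ge0.
have eK0 : 0 < e / K by rewrite divr_gt0.
apply/nbhs_ballP; exists (e / K) => // q /=; rewrite ballEmdist /=.
rewrite /mdist/= -[p in X in X -> _]to_torus_repr => /torus_dist_lift[v <- uv].
rewrite torus_mapE; apply: le_lt_trans (torus_dist_le _ _) _.
rewrite -mulmxBr; apply: le_lt_trans (enorm_mulmx _ _) _.
apply: (@le_lt_trans _ _ (K * enorm (repr p - v))).
  by rewrite ler_wpM2r ?enorm_ge0// lerDl.
by rewrite mulrC -ltr_pdivlMr.
Qed.

Lemma to_torus_continuous : continuous to_torus.
Proof.
move=> u; apply/(metricType_numDomainType.cvgrPdist_lt (FF := nbhs_filter _)) => e e0.
have e20 : 0 < e / 2 by rewrite divr_gt0.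
apply/nbhs_ballP; exists (e / 2) => //= v [_ uv].
rewrite /mdist/=; apply: le_lt_trans (torus_dist_le _ _) _.
apply: le_lt_trans (enorm_le_sum _) _.
rewrite !big_ord_recl big_ord0 addr0 !mxE.
have := uv ord0 0; have := uv (lift ord0 ord0) 0.
rewrite /ball/= => h1 h2; lra.
Qed.

Lemma torus_compact : compact [set: torus].
Proof.
pose box := [set v : 'rV[R]_2 | forall i, `[0, 1]%classic (v ord0 i)].
have box_compact : compact box.
  apply: (@rV_compact R _ (fun=> `[0, 1]%classic)) => i.
  exact: segment_compact.
have g_continuous : continuous (fun v : 'rV[R]_2 => to_torus v^T).
  move=> v; apply: (@continuous_comp _ _ _ trmx to_torus).
    move=> S /nbhs_ballP[e /= e0 eS]; apply/nbhs_ballP; exists e => //= w [_ vw].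
    by apply: eS; split=> // i j; rewrite !mxE; exact: vw.
  exact: to_torus_continuous.
suff -> : [set: torus] = (fun v : 'rV[R]_2 => to_torus v^T) @` box.
  apply: continuous_compact => //; exact: continuous_subspaceT.
apply/seteqP; split=> // p _.
pose w : 'cV[R]_2 := \col_i (repr p i 0 - (Num.floor (repr p i 0))%:~R).
exists (w^T).
  move=> i /=; rewrite !mxE in_itv/= subr_ge0 Num.Theory.ge_floor/=.
  by rewrite lerBlDr addrC -[1]/(1%:~R) -intrD ltW// Num.Theory.floorD1_gt.
rewrite trmxK -[RHS]to_torus_repr; apply/to_torusP/torus_equivP => i.
by rewrite !mxE addrC addrA addNr add0r rpredN intr_int.
Qed.

Definition torus_flow : flow R :=
  @Flow R torus torus_map torus_compact torus_map_continuous.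

End Torus.

(* Main.v *)
Require Import Defs.
From mathcomp Require Import all_boot all_order all_algebra.
From mathcomp Require Import all_classical all_reals all_analysis.
From mathcomp Require Import complex.
From mathcomp Require Import ring lra zify.

Set Implicit Arguments.
Unset Strict Implicit.
Unset Printing Implicit Defensive.

Import Order.TTheory GRing.Theory Num.Theory.
Import numFieldNormedType.Exports.
Import Normc.

(** The eigenvalues of [A] are the roots of a monic integer polynomial of
degree 2 and have modulus 1, so its trace is an integer of absolute value at
most 2, and is 0 when the determinant is -1.  For each of the six possible
characteristic polynomials some power [A ^+ k] is unipotent:
[(A ^+ k - 1) ^+ 2 = 0] ([quasiunipotent2]).  Hence
[A ^+ (m * k + r) = A ^+ r + m (A ^+ r) (A ^+ k - 1)], and the coordinates of
the lifted orbit [A ^+ n *m u] are, on each residue class of [n] modulo [k],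
affine functions of [n].

A character of the torus evaluated along the orbit is then [e(p n)], where
[e(t) = exp(2 pi i t)] and [p] is affine on each residue class modulo [k].
Detecting the residue class with [k]-th roots of unity turns [e(p n)] into a
finite linear combination of sequences [e(n b)], for which the weighted means
tend to 0 because [c] is oscillating ([null_mean_echar_affine_mod]).

To pass from trigonometric polynomials to a continuous [f], note that the growth
condition bounds the means of [|c_n|], since [|z| <= 1 + |z| ^ lambda].  So the
sequences whose [c]-weighted means tend to 0 are closed under uniform limits
([null_mean_uniform_limit]), and it is enough to approximate [f] uniformly by
trigonometric polynomials.  This is done by averaging [f] over a finite grid
against a product of Fejer kernels ([fejer_mean_approx]).  Sampling a Fejer kernel
of degree [m] on a grid of mesh [1 / (m + 2)] involves no aliasing, so the sampled
weights have total mass exactly 1 and second moment, in the sense of the mean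
of [1 - cos], exactly [1 / (m + 1)].  Since the modulus of continuity of [f] is
controlled by an arbitrarily small constant plus a multiple of [1 - cos]
([torus_modulus]), Korovkin's argument gives the approximation with finite sums
in place of integrals. *)

Local Open Scope classical_set_scope.
Local Open Scope ring_scope.
Local Open Scope complex_scope.

(** * Characters of the circle and the sampled Fejer kernel *)

Section Characters.
Variable R : realType.
Implicit Types (s t : R) (a b k m n : nat).

Definition echar t : R[i] := expi (2 * pi * t).

Lemma echarD s t : echar (s + t) = echar s * echar t.
Proof.
rewrite /echar /expi mulrDr cosD sinD; apply/eqP.
by rewrite eq_complex /= eqxx /= addrC [cos _ * sin _]mulrC mulrC.
Qed.

Lemma echar0 : echar 0 = 1.
Proof. by rewrite /echar /expi mulr0 cos0 sin0. Qed.

Lemma echar1 : echar 1 = 1.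
Proof. by rewrite /echar /expi mulr1 mulr_natl cos2pi sin2pi. Qed.

Lemma echarN t : echar (- t) = (echar t)^*.
Proof. by rewrite /echar /expi mulrN cosN sinN. Qed.

Lemma echarX t n : echar (n%:R * t) = echar t ^+ n.
Proof.
elim: n => [|n IH]; first by rewrite mul0r echar0.
by rewrite -natr1 mulrDl mul1r echarD IH exprSr.
Qed.

Lemma echar_nat n : echar n%:R = 1.
Proof. by rewrite -[n%:R]mulr1 echarX echar1 expr1n. Qed.

Lemma echar_int t : t \is a Num.int -> echar t = 1.
Proof.
move=> /intrP[[n|n] ->]; first exact: echar_nat.
by rewrite NegzE mulrNz echarN echar_nat conjc1.
Qed.

Lemma echar_neq1 t : 0 < t < 1 -> echar t != 1.
Proof.
move=> /andP[t0 t1]; have pi0 := @pi_gt0 R.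
have st : 0 < sin (pi * t).
  by apply: sin_gt0_pi; rewrite mulr_gt0//= gtr_pMr.
apply/eqP => -[]; have -> : 2 * pi * t = (pi * t) *+ 2 by ring.
rewrite cos_mulr2n cos2sin2 => h _.
have : sin (pi * t) ^+ 2 = 0 by lra.
by move/eqP; rewrite sqrf_eq0 gt_eqF.
Qed.

(** The geometric sum of the powers of a [k]-th root of unity.  It serves twice:
as orthogonality of characters on the grid, and to select one residue class
modulo [k]. *)
Lemma sum_echar_roots k a b : (a < k)%N -> (b < k)%N ->
  \sum_(j < k) echar (j%:R * ((a%:R - b%:R) / k%:R)) = (k * (a == b))%:R.
Proof.
move=> ak bk; have k0 : 0 < k%:R :> R by rewrite ltr0n (leq_trans _ ak).
set z := echar ((a%:R - b%:R) / k%:R).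
have -> : \sum_(j < k) echar (j%:R * ((a%:R - b%:R) / k%:R)) =
    \sum_(j < k) z ^+ j by apply: eq_bigr => j _; rewrite echarX.
have [abE|ab] := eqVneq a b; rewrite /=.
  have -> : z = 1 by rewrite /z abE subrr mul0r echar0.
  under eq_bigr do rewrite expr1n.
  by rewrite sumr_const card_ord muln1.
have zk : z ^+ k = 1.
  rewrite -echarX mulrC divfK ?gt_eqF// echar_int//.
  by rewrite rpredB// ?natr_int.
have z1 : z != 1.
  have pos c d : (c < k)%N -> (d < c)%N -> echar ((c%:R - d%:R) / k%:R) != 1.
    move=> ck dc; apply: echar_neq1; rewrite divr_gt0//=; last first.
      by rewrite subr_gt0 ltr_nat.
    rewrite ltr_pdivrMr// mul1r -natrB; last exact: ltnW.
    by rewrite ltr_nat (leq_ltn_trans (leq_subr _ _)).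
  have [ab'|ba|abE] := ltngtP a b; last by rewrite abE eqxx in ab.
    2: exact: pos.
  rewrite /z -opprB mulNr echarN; apply/eqP => h.
  by have /eqP := pos _ _ bk ab'; apply; rewrite -[LHS]conjcK h conjc1.
rewrite muln0; apply/eqP; have := subrX1 z k; rewrite zk subrr => /esym/eqP.
by rewrite mulf_eq0 subr_eq0 (negbTE z1).
Qed.

Lemma sum_echar_grid k a b s : (a < k)%N -> (b < k)%N ->
  \sum_(j < k) echar (a%:R * (s - j%:R / k%:R)) *
    echar (- (b%:R * (s - j%:R / k%:R))) = (k * (a == b))%:R.
Proof.
move=> ak bk; rewrite -[RHS]mul1r.
transitivity (echar ((a%:R - b%:R) * s) * (k * (b == a))%:R).
  rewrite -sum_echar_roots// mulr_sumr; apply: eq_bigr => j _.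
  by rewrite -!echarD; congr echar; ring.
by rewrite eq_sym; have [->|_] := eqVneq a b; rewrite ?muln0 ?mulr0// subrr mul0r echar0.
Qed.

Definition dirichlet m t : R[i] := \sum_(a < m) echar (a%:R * t).

(** The Fejer kernel built from [m.+1] frequencies, divided by the number
[m.+2] of sample points so that its samples sum to 1 instead of averaging to 1. *)
Definition fejer m t : R := normc (dirichlet m.+1 t) ^+ 2 / (m.+1 * m.+2)%:R.

Lemma fejer_ge0 m t : 0 <= fejer m t.
Proof. by rewrite divr_ge0// sqr_ge0. Qed.

Lemma fejerE m t : (fejer m t)%:C =
  \sum_(a < m.+1) \sum_(b < m.+1)
    (m.+1 * m.+2)%:R^-1 * (echar (a%:R * t) * echar (- (b%:R * t))).
Proof.
have -> : (fejer m t)%:C = (m.+1 * m.+2)%:R^-1 *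
    (dirichlet m.+1 t * (dirichlet m.+1 t)^*).
  rewrite -sqr_normc /fejer mulrC rmorphM/= fmorphV/= rmorphXn/= rmorph_nat.
  by rewrite normc_def; case: (dirichlet _ _).
rewrite rmorph_sum/= mulr_suml mulr_sumr; apply: eq_bigr => a _.
by rewrite !mulr_sumr; apply: eq_bigr => b _; rewrite echarN.
Qed.

(** The differences of the frequencies [0..m] are smaller than the number
[m.+2] of sample points, so that the diagonal terms alone survive the
summation over the grid. *)
Lemma fejer_sum m s :
  \sum_(j < m.+2) fejer m (s - j%:R / m.+2%:R) = 1.
Proof.
apply: (@complexI R); rewrite rmorph_sum/=.
under eq_bigr do rewrite fejerE.
rewrite exchange_big/=.
under eq_bigr => a _.
  rewrite exchange_big/=.
  under eq_bigr => b _.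
    rewrite -mulr_sumr sum_echar_grid ?(leq_trans (ltn_ord _))//.
    over.
  rewrite (bigD1 a)//= big1 ?addr0 ?eqxx ?muln1; last first.
    by move=> b ba; rewrite -val_eqE /= in ba; rewrite eq_sym (negbTE ba) muln0 mulr0.
  over.
rewrite sumr_const card_ord -mulr_natl natrM.
by field; rewrite -natrD nat1r !pnatr_eq0.
Qed.

(** Multiplying by [echar] shifts the first frequency by 1, to the range
[1..m.+1], which still fits below [m.+2]; only the [m] pairs of the form
[(a, a.+1)] survive.  The choice of [m.+2] rather than [m.+1] sample points is
made for this step. *)
Lemma fejer_moment m s :
  \sum_(j < m.+2) (fejer m (s - j%:R / m.+2%:R))%:C * echar (s - j%:R / m.+2%:R)
  = (m%:R / m.+1%:R)%:C.
Proof.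
transitivity (\sum_(a < m.+1) \sum_(b < m.+1)
    (m.+1 * m.+2)%:R^-1 * (m.+2 * (a.+1 == b))%:R : R[i]).
  under eq_bigr do rewrite fejerE mulr_suml.
  rewrite exchange_big/=; apply: eq_bigr => a _.
  under eq_bigr do rewrite mulr_suml.
  rewrite exchange_big/=; apply: eq_bigr => b _.
  rewrite -(@sum_echar_grid _ _ _ s) ?(leq_trans (ltn_ord _))//; last first.
    by rewrite ltnS ltn_ord.
  rewrite mulr_sumr; apply: eq_bigr => j _.
  rewrite -mulrA; congr (_ * _); rewrite mulrAC; congr (_ * _).
  by rewrite -echarD; congr echar; rewrite -natr1; ring.
rewrite exchange_big big_ord_recl/= big1 ?add0r; last first.
  by move=> a _; rewrite muln0 mulr0.
under eq_bigr => b _.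
  rewrite (bigD1 (widen_ord (leqnSn _) b))//= big1 ?addr0 ?eqxx ?muln1; last first.
    move=> a ab; rewrite -val_eqE /= in ab.
    by rewrite /bump /= add1n eqSS (negbTE ab) muln0 mulr0.
  over.
rewrite /= sumr_const card_ord -mulr_natl natrM rmorphM fmorphV !rmorph_nat.
by field; rewrite -natrD nat1r !pnatr_eq0.
Qed.

(** The concentration of the kernel near the integers, measured by
[1 - cos (2 pi t)], which vanishes at the integers only.  It tends to 0 with
[m], uniformly in [s]. *)
Lemma fejer_variance m s :
  \sum_(j < m.+2) fejer m (s - j%:R / m.+2%:R) *
     (1 - cos (2 * pi * (s - j%:R / m.+2%:R))) = m.+1%:R^-1.
Proof.
under eq_bigr do rewrite mulrBr mulr1.
rewrite sumrB fejer_sum.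
have /(congr1 (@complex.Re R)) := fejer_moment m s; rewrite raddf_sum/=.
under eq_bigr do rewrite /= mul0r subr0.
move=> ->; rewrite -natr1; field.
by rewrite natr1 pnatr_eq0.
Qed.

End Characters.

(** * Uniform approximation on the torus *)

Section ComplexModulus.
Variable R : realType.

Lemma normr_normc (z : R[i]) : `|z| = (normc z)%:C.
Proof. by rewrite normc_def; case: z. Qed.

Lemma normc_ge0 (z : R[i]) : 0 <= normc z.
Proof. by case: z => a b; exact: sqrtr_ge0. Qed.

Lemma normc_real (t : R) : normc t%:C = `|t|.
Proof. by rewrite /= expr0n /= addr0 sqrtr_sqr. Qed.

Lemma normcB (y z : R[i]) : normc (y - z) = normc (z - y).
Proof. by rewrite -normcN opprB. Qed.

Lemma normc_sum (I : Type) (r : seq I) (P : pred I) (F : I -> R[i]) :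
  normc (\sum_(i <- r | P i) F i) <= \sum_(i <- r | P i) normc (F i).
Proof.
elim/big_rec2: _ => [|i x y _ xy]; first by rewrite normc0.
by apply: le_trans (le_normcD _ _) _; rewrite lerD2l.
Qed.

Lemma near_normc_lt (T : Type) (F : set_system T) (FF : Filter F)
    (f : T -> R[i]^o) (y : R[i]^o) :
  f @ F --> y <->
  forall e : R, 0 < e -> \forall x \near F, normc (y - f x) < e.
Proof.
split=> [/cvgrPdist_lt fy e e0|fy].
  have /fy : 0 < e%:C by rewrite ltcR.
  by apply: filterS => x; rewrite normr_normc ltcR.
apply/cvgrPdist_lt => -[e e'] /[!ltcE]/= /andP[/eqP -> e0].
by apply: filterS (fy _ e0) => x; rewrite normr_normc ltcR.
Qed.

(** Heine's theorem: the local radii of continuity are made uniform by letting the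
radius [d] tend to 0 in the filter form of compactness. *)
Lemma heine (X : metricType R) (f : X -> R[i]^o) :
  compact [set: X] -> continuous f ->
  forall e : R, 0 < e ->
  exists2 d : R, 0 < d & forall p q, mdist p q < d -> normc (f p - f q) < e.
Proof.
move=> /compact_near_coveringP cX fc e e0.
have e20 : 0 < e / 2 by rewrite divr_gt0.
suff : \forall d \near (0 : R)^'+,
    [set: X] `<=` [set p | forall q, mdist p q < d -> normc (f p - f q) < e].
  move=> H; have [d [d0 dP]] := filter_ex (filterI (nbhs_right_gt 0) H).
  by exists d => // p q; exact: dP.
apply: cX => p _.
have /near_normc_lt /(_ _ e20)/nbhs_ballP[r /= r0 rP] := fc p.
have r20 : 0 < r / 2 by rewrite divr_gt0.
exists (ball p (r / 2), [set d | d < r / 2]).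
  by split => /=; [exact: nbhsx_ballx|exact: nbhs_right_lt].
move=> [q d] /= [pq dr] q' qq'.
have pq' : mdist p q' < r.
  have : ball p (r / 2 + r / 2) q'.
    apply: ball_triangle pq _; rewrite ballEmdist /=; exact: lt_trans qq' dr.
  by rewrite -splitr ballEmdist.
have h1 : normc (f p - f q) < e / 2.
  by apply: rP; apply: (le_ball _ pq); lra.
have h2 : normc (f p - f q') < e / 2 by apply: rP; rewrite ballEmdist.
rewrite -(subrK (f p) (f q)) -addrA.
apply: le_lt_trans (le_normcD _ _) _; rewrite normcB; lra.
Qed.

Lemma compact_normc_bounded (X : metricType R) (f : X -> R[i]^o) :
  compact [set: X] -> continuous f ->
  exists M : R, forall p, normc (f p) <= M.
Proof.
move=> /compact_near_coveringP cX fc.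
suff : \forall M \near +oo, [set: X] `<=` [set p | normc (f p) <= M].
  by move=> /filter_ex[M MP]; exists M => p; exact: MP.
apply: cX => p _.
have /near_normc_lt /(_ _ ltr01) fp := fc p.
exists ([set q | normc (f p - f q) < 1], [set M | normc (f p) + 1 < M]).
  by split => //=; apply: nbhs_pinfty_gt; exact: num_real.
move=> [q M] /= [pq pM].
rewrite -(subrK (f p) (f q)).
apply: le_trans (le_normcD _ _) _; rewrite normcB; lra.
Qed.

End ComplexModulus.

Section FejerApproximation.
Variable R : realType.
Implicit Types (u v : 'cV[R]_2).

Lemma cos2pi_int (t k : R) : k \is a Num.int ->
  cos (2 * pi * (t + k)) = cos (2 * pi * t).
Proof.
by move=> kZ; have := echarD t k; rewrite (echar_int kZ) mulr1 => -[].
Qed.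

(** Half the squared distance between the images of [u] and [v] under the
embedding of the torus in a product of two unit circles.  Unlike the torus
distance, it is a trigonometric polynomial, so that its Fejer means can be
computed exactly. *)
Definition chord2 u v : R := \sum_(i < 2) (1 - cos (2 * pi * (u i 0 - v i 0))).

Lemma chord2_ge0 u v : 0 <= chord2 u v.
Proof. by apply: sumr_ge0 => i _; rewrite subr_ge0 cos_le1. Qed.

(** Subtracting from [v] the nearest integer vector makes every coordinate of
the difference at most 1/2 in absolute value.  One of them, being at least
[d / 2], contributes at least [1 - cos (pi d)] since the cosine decreases on
[[0, pi]]; the minimum with 1/2 keeps the angle in that interval. *)
Lemma chord2_away (d : R) : 0 < d -> exists2 e : R, 0 < e &
  forall u v, d <= torus_dist (to_torus u) (to_torus v) -> e <= chord2 u v.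
Proof.
move=> d0; have pi0 := @pi_gt0 R.
pose h := Num.min (d / 2) 2^-1.
have h0 : 0 < h by rewrite lt_min divr_gt0// invr_gt0 ltr0n.
have h2 : h <= 2^-1 by rewrite ge_min lexx orbT.
have hd : h <= d / 2 by rewrite ge_min lexx.
have pih : 2 * pi * h <= pi.
  by rewrite mulrAC -ler_pdivlMr// divff ?gt_eqF//; lra.
have pih0 : 0 < 2 * pi * h by rewrite !mulr_gt0.
exists (1 - cos (2 * pi * h)).
  rewrite subr_gt0 -[ltRHS]cos0 ltr_cos ?in_itv/= ?lexx ?pih ?(ltW pih0) ?(ltW pi0)//.
move=> u v duv.
pose k : 'cV[R]_2 := \col_i (Num.floor (u i 0 - v i 0 + 2^-1))%:~R.
pose t i := u i 0 - v i 0 - k i 0.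
have kZ i : k i 0 \is a Num.int by rewrite mxE intr_int.
have t2 i : `|t i| <= 2^-1.
  rewrite /t mxE; set x := u i 0 - v i 0.
  have := floor_itv (x + 2^-1).
  rewrite intrD => /andP[h3 h4]; rewrite ler_norml.
  by apply/andP; split; lra.
have dt : d <= \sum_(i < 2) `|t i|.
  have -> : \sum_(i < 2) `|t i| = \sum_(i < 2) `|(u - (v + k)) i 0|.
    by apply: eq_bigr => i _; rewrite /t !mxE opprD addrA.
  apply: le_trans (enorm_le_sum _); apply: le_trans (torus_dist_le _ _).
  suff -> : to_torus (v + k) = to_torus v by [].
  by apply/to_torusP/torus_equivP => i; rewrite !mxE addrAC subrr add0r intr_int.
have [i hti] : exists i, h <= `|t i|.
  apply/not_existsP => H; move: dt; apply/negP; rewrite -ltNge.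
  rewrite !big_ord_recl big_ord0 addr0.
  have /negP := H ord0; have /negP := H (lift ord0 ord0).
  rewrite -!ltNge => ? ?; lra.
rewrite /chord2 (bigD1 i)//= -[leLHS]addr0; apply: lerD; last first.
  by apply: sumr_ge0 => j _; rewrite subr_ge0 cos_le1.
rewrite lerD2l lerN2.
have -> : cos (2 * pi * (u i 0 - v i 0)) = cos (2 * pi * `|t i|).
  have tpi : `|2 * pi| = 2 * pi :> R by rewrite gtr0_norm ?mulr_gt0.
  rewrite -[in RHS]tpi -normrM cos_norm; apply/esym/cos2pi_int.
  by rewrite rpredN.
have piti : 2 * pi * `|t i| <= pi.
  by rewrite mulrAC -ler_pdivlMr// divff ?gt_eqF//; have := t2 i; lra.
have piti0 : 0 <= 2 * pi * `|t i| by rewrite !mulr_ge0// ltW.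
rewrite leNgt ltr_cos ?in_itv/= ?piti ?pih ?(ltW pih0) ?piti0//.
by rewrite ltr_pM2l ?mulr_gt0// -leNgt.
Qed.

(** Points closer than the radius of uniform continuity are handled by [e]; for
the others the difference is at most twice the bound of [f], and [chord2] is
bounded below. *)
Lemma torus_modulus (f : torus R -> R[i]^o) : continuous f ->
  forall e : R, 0 < e -> exists2 C : R, 0 <= C & forall u v,
    normc (f (to_torus u) - f (to_torus v)) <= e + C * chord2 u v.
Proof.
move=> fc e e0.
have [d d0 dP] := heine (@torus_compact R) fc e0.
have [M MP] := compact_normc_bounded (@torus_compact R) fc.
have [a a0 aP] := chord2_away d0.
have M0 : 0 <= M by apply: le_trans (normc_ge0 _) (MP (to_torus 0)).
have C0 : 0 <= 2 * M / a by apply: divr_ge0; [exact: mulr_ge0|exact: ltW].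
exists (2 * M / a) => // u v.
have [lt|ge] := ltP (torus_dist (to_torus u) (to_torus v)) d.
  apply: le_trans (ltW (dP _ _ lt)) _.
  by rewrite lerDl mulr_ge0// chord2_ge0.
apply: le_trans (le_normcD _ _) _; rewrite normcN.
apply: (@le_trans _ _ (2 * M / a * a)).
  rewrite divfK ?gt_eqF//; have := MP (to_torus u); have := MP (to_torus v); lra.
apply: (@le_trans _ _ (2 * M / a * chord2 u v)).
  by rewrite ler_wpM2l// aP.
by rewrite lerDr ltW.
Qed.

Definition grid m (j : 'I_m.+2 * 'I_m.+2) : 'cV[R]_2 :=
  \col_i (if i == 0 then j.1%:R / m.+2%:R else j.2%:R / m.+2%:R).

Definition fejer2 m (j : 'I_m.+2 * 'I_m.+2) u : R :=
  fejer m (u 0 0 - j.1%:R / m.+2%:R) * fejer m (u 1 0 - j.2%:R / m.+2%:R).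

Definition fejer_mean m (f : torus R -> R[i]) u : R[i] :=
  \sum_j f (to_torus (grid j)) * (@fejer2 m j u)%:C.

Lemma fejer2_sum m u : \sum_j @fejer2 m j u = 1.
Proof.
rewrite /fejer2 -(pair_bigA _ (fun j1 j2 : 'I_m.+2 =>
  fejer m (u 0 0 - j1%:R / m.+2%:R) * fejer m (u 1 0 - j2%:R / m.+2%:R)))/=.
under eq_bigr do rewrite -mulr_sumr fejer_sum mulr1.
exact: fejer_sum.
Qed.

(** Each coordinate contributes the variance of a one-dimensional kernel, the
other kernel having total mass 1. *)
Lemma fejer2_chord2 m u :
  \sum_j @fejer2 m j u * chord2 u (grid j) = 2 / m.+1%:R.
Proof.
pose w (x : R) (j : 'I_m.+2) := fejer m (x - j%:R / m.+2%:R).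
pose g (x : R) (j : 'I_m.+2) := 1 - cos (2 * pi * (x - j%:R / m.+2%:R)).
transitivity (\sum_(j1 < m.+2) \sum_(j2 < m.+2)
  (w (u 0 0) j1 * g (u 0 0) j1 * w (u 1 0) j2 +
   w (u 0 0) j1 * (w (u 1 0) j2 * g (u 1 0) j2))).
  rewrite pair_bigA; apply: eq_bigr => j _ /=.
  rewrite /chord2 !big_ord_recl big_ord0 /fejer2 !mxE /=.
  have -> : lift ord0 ord0 = 1 :> 'I_2 by apply/val_inj.
  rewrite /w /g; ring.
under eq_bigr do rewrite big_split/= -!mulr_sumr fejer_sum mulr1 fejer_variance.
rewrite big_split/= -mulr_suml fejer_sum fejer_variance; ring.
Qed.

Lemma fejer_mean_approx (f : torus R -> R[i]^o) : continuous f ->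
  forall e : R, 0 < e -> exists m, forall u,
    normc (f (to_torus u) - fejer_mean m f u) <= e.
Proof.
move=> fc e e0; have e20 : 0 < e / 2 by rewrite divr_gt0.
have [C C0 CP] := torus_modulus fc e20.
(* The chord term is at most 2 C / (m + 1), to be made at most e / 2. *)
pose m := Num.truncn (4 * C / e); exists m => u.
have Cm : C * (2 / m.+1%:R) <= e / 2.
  rewrite mulrA ler_pdivrMr ?ltr0n//.
  have : 4 * C / e < m.+1%:R by exact: truncnS_gt.
  by rewrite ltr_pdivrMr// => ?; lra.
have -> : f (to_torus u) - fejer_mean m f u =
    \sum_j (f (to_torus u) - f (to_torus (grid j))) * (@fejer2 m j u)%:C.
  under eq_bigr do rewrite mulrBl.
  by rewrite sumrB -mulr_sumr -rmorph_sum/= fejer2_sum mulr1.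
apply: le_trans (normc_sum _ _ _) _.
apply: (@le_trans _ _ (\sum_j (e / 2 * @fejer2 m j u
    + C * (@fejer2 m j u * chord2 u (grid j))))).
  apply: ler_sum => j _; have w0 : 0 <= fejer2 j u by rewrite mulr_ge0// fejer_ge0.
  rewrite normcM normc_real ger0_norm//.
  apply: le_trans (ler_wpM2r w0 (CP _ _)) _.
  by rewrite mulrDl lerD2l mulrAC -mulrA.
rewrite big_split/= -!mulr_sumr fejer2_sum fejer2_chord2.
by rewrite mulr1 [leRHS]splitr lerD2l.
Qed.

End FejerApproximation.

(** * Sequences with null weighted means *)

Section NullMeans.
Variables (R : realType) (c : nat -> R[i]).
Implicit Types (phi psi : nat -> R[i]) (b : R).

Definition null_mean phi : Prop :=
  cesaro_mean (fun n => c n * phi n) @ \oo --> (0 : R[i]^o).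

Lemma eq_null_mean phi psi : phi =1 psi -> null_mean phi -> null_mean psi.
Proof. by move=> /funext ->. Qed.

Lemma null_meanD phi psi : null_mean phi -> null_mean psi ->
  null_mean (fun n => phi n + psi n).
Proof.
rewrite /null_mean => h1 h2.
have -> : cesaro_mean (fun n => c n * (phi n + psi n)) =
    cesaro_mean (fun n => c n * phi n) \+ cesaro_mean (fun n => c n * psi n).
  apply/funext => N; rewrite /cesaro_mean /= -mulrDr -big_split/=.
  by congr (_ * _); apply: eq_bigr => n _; rewrite mulrDr.
by rewrite -[0]addr0; exact: cvgD.
Qed.

Lemma null_meanZ (a : R[i]) phi : null_mean phi ->
  null_mean (fun n => a * phi n).
Proof.
rewrite /null_mean => h.
have -> : cesaro_mean (fun n => c n * (a * phi n)) =
    a \*: (cesaro_mean (fun n => c n * phi n) : nat -> R[i]^o).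
  apply/funext => N; rewrite /cesaro_mean /= /GRing.scale/= [RHS]mulrCA [in RHS]mulr_sumr.
  by congr (_ * _); apply: eq_bigr => n _; rewrite mulrCA.
by rewrite -[0](scaler0 _ a); exact: cvgZr.
Qed.

Lemma null_mean0 : null_mean (fun=> 0).
Proof.
rewrite /null_mean; have -> : cesaro_mean (fun n => c n * 0) = fun=> 0.
  by apply/funext => N; rewrite /cesaro_mean big1 ?mulr0// => n _; rewrite mulr0.
exact: cvg_cst.
Qed.

Lemma null_mean_sum (I : Type) (r : seq I) (F : I -> nat -> R[i]) :
  (forall i, null_mean (F i)) -> null_mean (fun n => \sum_(i <- r) F i n).
Proof.
move=> h; elim: r => [|i r IH].
  by apply: eq_null_mean null_mean0 => n; rewrite big_nil.
apply: eq_null_mean (null_meanD (h i) IH) => n; by rewrite big_cons.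
Qed.

(** [|z| <= 1 + |z| ^ lambda] for [lambda >= 1], by comparing [|z|] with 1. *)
Lemma growth_mean_bounded (lambda : R) : 1 <= lambda ->
  growth_condition lambda c ->
  exists B : R, \forall N \near \oo, \sum_(1 <= n < N.+1) normc (c n) <= B * N%:R.
Proof.
move=> l1 /eqO_exP[B [B0 hB]]; exists (1 + B).
apply: filterS hB => N; rewrite ger0_norm; last first.
  by apply: sumr_ge0 => n _; exact: powR_ge0.
rewrite ger0_norm// => hN.
apply: (@le_trans _ _ (\sum_(1 <= n < N.+1) (1 + normc (c n) `^ lambda))).
  apply: ler_sum => n _; have [lt|ge] := leP (normc (c n)) 1.
    by apply: le_trans lt _; rewrite lerDl powR_ge0.
  by apply: le_trans (le1r_powR (ltW ge) l1) _; rewrite lerDr.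
rewrite big_split/= mulrDl; apply: lerD => //.
by rewrite big_const_nat iter_addr_0 subn1 /= mul1r.
Qed.

Lemma null_mean_uniform_limit (B : R) phi :
  (\forall N \near \oo, \sum_(1 <= n < N.+1) normc (c n) <= B * N%:R) ->
  (forall e : R, 0 < e -> exists2 psi, null_mean psi &
     forall n, normc (phi n - psi n) <= e) ->
  null_mean phi.
Proof.
move=> hB happrox; apply/near_normc_lt => e e0.
pose e' := e / 2 / (`|B| + 1).
have B1 : 0 < `|B| + 1 by rewrite ltr_wpDl.
have e20 : 0 < e / 2 by rewrite divr_gt0.
have e'0 : 0 < e' by rewrite divr_gt0.
have [psi /near_normc_lt /(_ _ e20) hpsi hphi] := happrox _ e'0.
near=> N.
have N0 : (0 < N)%N by near: N; exact: nbhs_infty_gt.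
have N0' : 0 < N%:R :> R by rewrite ltr0n.
have -> : 0 - cesaro_mean (fun n => c n * phi n) N =
    (0 - cesaro_mean (fun n => c n * psi n) N)
    - cesaro_mean (fun n => c n * (phi n - psi n)) N.
  rewrite /cesaro_mean !sub0r -opprD -mulrDr -big_split/=.
  by congr (- (_ * _)); apply: eq_bigr => n _; rewrite -mulrDr addrC subrK.
apply: le_lt_trans (le_normcD _ _) _; rewrite normcN [e]splitr.
apply: ltr_leD; first by near: N.
have NC : N%:R = (N%:R)%:C :> R[i] by rewrite rmorph_nat.
rewrite /cesaro_mean normcM normcV NC normc_real ger0_norm//.
rewrite ler_pdivrMl//; apply: le_trans (normc_sum _ _ _) _.
apply: (@le_trans _ _ (\sum_(1 <= n < N.+1) normc (c n) * e')).
  by apply: ler_sum => n _; rewrite normcM ler_wpM2l ?normc_ge0.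
rewrite -mulr_suml; apply: (@le_trans _ _ (B * N%:R * e')).
  by rewrite ler_wpM2r ?(ltW e'0)//; near: N.
rewrite mulrAC mulrC ler_wpM2l ?(ltW N0')//.
have -> : e / 2 = (`|B| + 1) * e' by rewrite [RHS]mulrC /e' divfK ?gt_eqF.
rewrite ler_wpM2r ?(ltW e'0)//.
by apply: le_trans (ler_norm B) _; rewrite lerDl.
Unshelve. all: by end_near. Qed.

Hypothesis c_osc : oscillating c.

(** The definition of [oscillating] tests frequencies in [[0, 1)] with a minus
sign in the exponent, whence the fractional part of [- b]. *)
Lemma null_mean_echar b : null_mean (fun n => echar (n%:R * b)).
Proof.
pose t := - b - (Num.floor (- b))%:~R.
have t01 : 0 <= t < 1.
  have /andP[h1 h2] := floor_itv (- b); move: h2; rewrite intrD => h2.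
  by rewrite /t; apply/andP; split; lra.
rewrite /null_mean; have := c_osc t01; suff -> : (fun n => c n * echar (n%:R * b)) =
  (fun n => c n * expi (- (2 * pi * n%:R * t))) by [].
apply/funext => n; congr (_ * _).
have -> : - (2 * pi * n%:R * t) = 2 * pi * (n%:R * b + n%:R * (Num.floor (- b))%:~R).
  by rewrite /t; ring.
rewrite -/(echar _) echarD [X in _ = _ * X]echar_int ?mulr1//.
by rewrite rpredM ?natr_int ?intr_int.
Qed.

(** Write the indicator of a residue class [r] as the mean over [j < k] of
[echar (j (n - r) / k)].  On that class [n %/ k] equals [(n - r) / k], which makes
the phase a function of the form [constant + n b] with
[b = (j + beta r) / k]. *)
Lemma null_mean_echar_affine_mod (k : nat) (p : nat -> R) (alpha beta : nat -> R) :
  (0 < k)%N ->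
  (forall m r, (r < k)%N -> p (m * k + r)%N = alpha r + m%:R * beta r) ->
  null_mean (fun n => echar (p n)).
Proof.
move=> k0 hp; have k0' : k%:R != 0 :> R by rewrite pnatr_eq0 -lt0n.
have k0C : k%:R != 0 :> R[i] by rewrite pnatr_eq0 -lt0n.
pose a (r j : 'I_k) := (k%:R)^-1 *
  echar (alpha r - r%:R * ((j%:R + beta r) / k%:R)).
apply: (@eq_null_mean (fun n => \sum_(r < k) \sum_(j < k)
    a r j * echar (n%:R * ((j%:R + beta r) / k%:R)))); last first.
  apply: null_mean_sum => r; apply: null_mean_sum => j.
  by apply: null_meanZ; exact: null_mean_echar.
move=> n; rewrite {2}(divn_eq n k) hp ?ltn_mod//.
pose r0 : 'I_k := Ordinal (ltn_pmod n k0).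
transitivity (\sum_(r < k) echar (alpha r + (n%:R - r%:R) / k%:R * beta r) *
    ((k * (r0 == r :> nat))%:R / k%:R)).
  apply: eq_bigr => r _; rewrite -sum_echar_roots ?ltn_ord//.
  rewrite mulr_suml mulr_sumr; apply: eq_bigr => j _.
  have -> : echar (j%:R * ((r0%:R - r%:R) / k%:R)) =
      echar (j%:R * ((n%:R - r%:R) / k%:R)) :> R[i].
    rewrite [in RHS](divn_eq n k) natrD natrM.
    have -> : j%:R * (((n %/ k)%:R * k%:R + (n %% k)%:R - r%:R) / k%:R) =
      j%:R * (((n %% k)%:R - r%:R) / k%:R) + (j * (n %/ k))%:R :> R.
      by rewrite natrM; field.
    by rewrite echarD echar_nat mulr1.
  rewrite /a -mulrA -echarD [RHS]mulrA -echarD [RHS]mulrC.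
  by congr (_ * echar _); field.
rewrite (bigD1 r0)//= big1 ?addr0; last first.
  move=> r; rewrite -val_eqE /= => /negbTE rr0.
  by rewrite eq_sym rr0 muln0 mul0r mulr0.
rewrite eqxx muln1 divff// mulr1; congr echar; congr (_ + _ * _).
by rewrite {1}(divn_eq n k) natrD natrM addrK mulfK.
Qed.

End NullMeans.

(** * Integer matrices with spectrum on the unit circle *)

Section Quasiunipotent.

Lemma char_poly2 (K : comNzRingType) (A : 'M[K]_2) :
  char_poly A = 'X^2 - \tr A *: 'X + (\det A)%:P.
Proof.
apply/polyP => -[|[|i]]; rewrite !coefD coefN coefZ coefXn coefX coefC /=.
- by rewrite char_poly_det sqrrN expr1n mul1r mulr0 subr0 add0r.
- by rewrite [LHS](char_poly_trace A (isT : (0 < 2)%N)) mulr1 addr0 sub0r.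
rewrite mulr0 subr0 addr0; case: i => [|i].
  by have /monicP := char_poly_monic A; rewrite lead_coefE size_char_poly.
by rewrite nth_default// size_char_poly.
Qed.

Lemma eigenvalues2 (F : closedFieldType) (B : 'M[F]_2) :
  exists z1 z2, [/\ eigenvalue B z1, eigenvalue B z2,
    \tr B = z1 + z2 & \det B = z1 * z2].
Proof.
have [s sE] := closed_field_poly_normal (char_poly B).
have mon := char_poly_monic B; move: sE; rewrite (monicP mon) scale1r => sE.
have ssz : size s = 2%N.
  by have := size_char_poly B; rewrite sE size_prod_XsubC => -[].
case: s ssz sE => [|z1 [|z2 []]]//= _; rewrite !big_cons big_nil mulr1 => sE.
exists z1, z2; rewrite !eigenvalue_root_char sE !rootM !root_XsubC !eqxx orbT.
have cE : 'X^2 - \tr B *: 'X + (\det B)%:P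
    = 'X^2 - (z1 + z2) *: 'X + (z1 * z2)%:P.
  by rewrite -char_poly2 sE -!mul_polyC polyCD polyCM; ring.
split=> //.
  have /(congr1 (coefp 1)) := cE; rewrite /= !coefD !coefN !coefZ coefXn coefX !coefC /=.
  by rewrite !mulr1 !addr0 !sub0r => /oppr_inj.
have /(congr1 (coefp 0)) := cE; rewrite /= !coefD !coefN !coefZ coefXn coefX !coefC /=.
by rewrite !mulr0 !subr0 !add0r.
Qed.

(** The trace is the sum of two complex numbers of modulus 1.  If their product
is -1 they are [z] and [- z^*], so that the trace is both real and purely
imaginary. *)
Lemma unit_eigenvalues_trace (R : realType) (A : 'M[int]_2) : SL_Z2 A ->
  eigenvalues_on_unit_circle R A ->
  (\det A = 1 /\ `|\tr A| <= 2) \/ (\det A = -1 /\ \tr A = 0).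
Proof.
move=> SA hA; set B : 'M[R[i]]_2 := map_mx intr A.
have [z1 [z2 [/hA n1 /hA n2 trE detE]]] := eigenvalues2 B.
have trB : \tr B = (\tr A)%:~R by rewrite -trace_map_mx.
have detB : \det B = (\det A)%:~R by rewrite -det_map_mx.
rewrite {}trB in trE; rewrite {}detB in detE.
case: SA => dA; [left|right]; split=> //.
  have : (`|\tr A|)%:~R <= 2%:~R :> R[i].
    rewrite intr_norm trE; apply: le_trans (ler_normD _ _) _.
    by rewrite n1 n2.
  by rewrite ler_int.
have z1J : z1 * z1^* = 1 by rewrite -sqr_normc n1 expr1n.
have z2E : z2 = - z1^*.
  have z10 : z1 != 0 by rewrite -normr_eq0 n1 oner_eq0.
  by apply: (mulfI z10); rewrite mulrN z1J -detE dA.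
have : ((\tr A)%:~R)^* = - (\tr A)%:~R :> R[i].
  by rewrite trE z2E rmorphB /= conjcK opprB.
rewrite rmorph_int => /eqP; rewrite -subr_eq0 opprK -mulr2n mulrn_eq0 /=.
by rewrite intr_eq0 => /eqP.
Qed.

(** By Cayley-Hamilton it is enough that the characteristic polynomial divides
[('X^k - 1) ^+ 2]; the cofactor is exhibited in each of the six cases.  Except
for [('X - 1) ^+ 2] and [('X + 1) ^+ 2], the polynomial is a product of distinct
cyclotomic factors and already divides [('X^k - 1)]. *)
Lemma quasiunipotent2 (R : realType) (A : 'M[int]_2) : SL_Z2 A ->
  eigenvalues_on_unit_circle R A ->
  exists2 k, (0 < k)%N & (A ^+ k - 1) * (A ^+ k - 1) = 0.
Proof.
move=> SA hA.
have annihilates k (Q : {poly int}) :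
    ('X^k - 1) * ('X^k - 1) = Q * char_poly A ->
    (A ^+ k - 1) * (A ^+ k - 1) = 0.
  move=> /(congr1 (horner_mx A)).
  by rewrite !rmorphM !rmorphB/= rmorphXn rmorph1/= horner_mx_X Cayley_Hamilton mulr0.
have [[dA tA]|[dA tA]] := unit_eigenvalues_trace SA hA; last first.
  exists 2%N => //; apply: (annihilates _ ('X^2 - 1)).
  by rewrite char_poly2 dA tA -mul_polyC ?rmorphN ?rmorph_nat ?rmorph1 ?rmorph0; ring.
have [t2|[t2|[t2|[t2|t2]]]] : \tr A = 2 \/ \tr A = -2 \/ \tr A = 1 \/
  \tr A = -1 \/ \tr A = 0 by lia.
- exists 1%N => //; apply: (annihilates _ 1).
  by rewrite char_poly2 dA t2 -mul_polyC ?rmorphN ?rmorph_nat ?rmorph1 ?rmorph0; ring.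
- exists 2%N => //; apply: (annihilates _ (('X - 1) * ('X - 1))).
  by rewrite char_poly2 dA t2 -mul_polyC ?rmorphN ?rmorph_nat ?rmorph1 ?rmorph0; ring.
- exists 6%N => //.
  apply: (annihilates _ ((('X^3 - 1) * ('X + 1)) ^+ 2 * ('X^2 - 'X + 1))).
  by rewrite char_poly2 dA t2 -mul_polyC ?rmorphN ?rmorph_nat ?rmorph1 ?rmorph0; ring.
- exists 3%N => //; apply: (annihilates _ (('X - 1) ^+ 2 * ('X^2 + 'X + 1))).
  by rewrite char_poly2 dA t2 -mul_polyC ?rmorphN ?rmorph_nat ?rmorph1 ?rmorph0; ring.
- exists 4%N => //; apply: (annihilates _ (('X^2 - 1) ^+ 2 * ('X^2 + 1))).
  by rewrite char_poly2 dA t2 -mul_polyC ?rmorphN ?rmorph_nat ?rmorph1 ?rmorph0; ring.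
Qed.

End Quasiunipotent.

(** * Orbits of the torus map *)

Section TorusOrbits.
Variable R : realType.

Lemma iter_torus_map (A : 'M[int]_2) (u : 'cV[R]_2) n :
  iter n (@torus_map R A) (to_torus u) = to_torus ((map_mx intr A : 'M[R]_2) ^+ n *m u).
Proof.
elim: n => [|n IH]; first by rewrite expr0 mul1mx.
by rewrite iterS IH torus_mapE mulmxA -[_ *m _ ^+ _]/(_ * _) -exprS.
Qed.

Lemma quasiunipotent_expr (K : pzRingType) (B : K) (k m r : nat) :
  (B ^+ k - 1) * (B ^+ k - 1) = 0 ->
  B ^+ (m * k + r) = B ^+ r + (B ^+ r * (B ^+ k - 1)) *+ m.
Proof.
set N := B ^+ k - 1 => N2; have BkE : B ^+ k = 1 + N by rewrite addrC subrK.
have -> : B ^+ (m * k + r) = B ^+ r * (1 + N) ^+ m.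
  by rewrite -BkE -exprM -exprD addnC mulnC.
have -> : (1 + N) ^+ m = 1 + N *+ m.
  elim: m => [|m IH]; first by rewrite expr0 mulr0n addr0.
  rewrite exprSr IH mulrDr mulr1 mulrDl mul1r mulrnAl N2 mul0rn addr0 mulrS.
  by rewrite -addrA [_ + N]addrC.
by rewrite mulrDr mulr1 mulrnAr.
Qed.

(** Expanding both kernels gives a combination of characters of the torus, whose
phases along the orbit are affine on each residue class modulo [k]. *)
Lemma null_mean_fejer2_orbit (c : nat -> R[i]) (B : 'M[R]_2) (u : 'cV[R]_2) k m
    (j : 'I_m.+2 * 'I_m.+2) :
  oscillating c -> (0 < k)%N -> (B ^+ k - 1) * (B ^+ k - 1) = 0 ->
  null_mean c (fun n => (@fejer2 R m j (B ^+ n *m u))%:C).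
Proof.
move=> c_osc k0 Bk.
pose y i n := (B ^+ n *m u) i 0; pose z i n := (B ^+ n *m ((B ^+ k - 1) *m u)) i 0.
have yE i q r : y i (q * k + r)%N = y i r + q%:R * z i r.
  rewrite /y /z quasiunipotent_expr// mulmxDl mulmxA !mxE; congr (_ + _).
  rewrite mulr_sumr; apply: eq_bigr => l _.
  by rewrite mulmxnE -[_ *m _]/(_ * _) mulrA mulr_natl.
pose C : R[i] := (m.+1 * m.+2)%:R^-1.
pose s (a b : 'I_m.+1) (x : nat) t : R := (a%:R - b%:R) * (t - x%:R / m.+2%:R).
pose phi n := \sum_(a < m.+1) \sum_(b < m.+1)
   \sum_(a' < m.+1) \sum_(b' < m.+1) (C * C) *
     echar (s a b j.1 (y 0 n) + s a' b' j.2 (y 1 n)).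
apply: (@eq_null_mean _ _ phi); last first.
  apply: null_mean_sum => a; apply: null_mean_sum => b.
  apply: null_mean_sum => a'; apply: null_mean_sum => b'; apply: null_meanZ.
  apply: (@null_mean_echar_affine_mod _ _ c_osc k _
    (fun r => s a b j.1 (y 0 r) + s a' b' j.2 (y 1 r))
    (fun r => (a%:R - b%:R) * z 0 r + (a'%:R - b'%:R) * z 1 r)) => // q r _.
  by rewrite !yE /s; ring.
move=> n; rewrite /fejer2 rmorphM/= !fejerE mulr_suml; apply: eq_bigr => a _.
rewrite mulr_suml; apply: eq_bigr => b _.
rewrite mulr_sumr; apply: eq_bigr => a' _.
rewrite mulr_sumr; apply: eq_bigr => b' _.
rewrite -!echarD -/C mulrACA -echarD; congr (_ * echar _).
by rewrite /s /y; ring.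
Qed.

End TorusOrbits.

Theorem corollary8 (R : realType) (A : 'M[int]_2)
  (A_SL : SL_Z2 A)
  (A_eig : eigenvalues_on_unit_circle R A)
  (c : nat -> R[i]) (c_osc : oscillating c)
  (lambda : R) (lambda_gt1 : 1 < lambda)
  (c_growth : growth_condition lambda c) :
  linearly_disjoint c (torus_flow R A).
Proof.
move=> f fc x; rewrite -(to_torus_repr x); set u := repr x.
have [k k0 Ak] := quasiunipotent2 A_SL A_eig.
pose B : 'M[R]_2 := map_mx intr A.
have Bk : (B ^+ k - 1) * (B ^+ k - 1) = 0.
  have /(congr1 (map_mx (intr : int -> R))) := Ak.
  by rewrite map_mx0 rmorphM rmorphB rmorphXn rmorph1.
have [b hb] := growth_mean_bounded (ltW lambda_gt1) c_growth.
apply: (null_mean_uniform_limit hb) => e e0.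
have [m mP] := fejer_mean_approx fc e0.
exists (fun n => fejer_mean m f (B ^+ n *m u)); last first.
  by move=> n; rewrite /= iter_torus_map; exact: mP.
apply: null_mean_sum => j; apply: null_meanZ.
exact: null_mean_fejer2_orbit c_osc k0 Bk.
Qed.
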